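(* For all positive integers $n,d$, with $\mathrm{ldes}$ and $\mathrm{lexc}$ taken with respect to the min-one order on $[n]\times[d]_0$, there exists a bijection $\Gamma:\mathfrak{S}_n^d\to\mathfrak{S}_n^d$ such that $\mathrm{ldes}(p)=\mathrm{lexc}(\Gamma(p))$ for all $p\in\mathfrak{S}_n^d$, and which additionally satisfies $\Gamma(S_{(i,j)})=S_{(n+2-i,\;d-1-j)}$ for all $2\le i\le n$ and $j\in[d]_0$, and $\Gamma(S_{(1,j)})=S_{(1,\;d-1-j)}$ for all $j\in[d]_0$.
   Context: Notation: $[n]=\{1,\dots,n\}$ and $[d]_0=\{0,1,\dots,d-1\}$. $\mathfrak{S}_n$ is the set of permutations of $[n]$, written as words $\pi=\pi_1\pi_2\cdots\pi_n$. The set of colored permutations $\mathfrak{S}_n^d$ consists of all pairs $p=(\pi,c)$ with $\pi\in\mathfrak{S}_n$ and $c=(c_1,\dots,c_n)\in([d]_0)^n$. For $(i,j)\in[n]\times[d]_0$, $S_{(i,j)}$ is the set of $(\pi,c)\in\mathfrak{S}_n^d$ with $\pi_1=i$ and $c_1=j$. Write $i_j$ for the pair $(i,j)$. The min-one order $>_{\mathrm{mo}}$ on $[n]\times[d]_0$ is the linear order $$1_0<1_1<\cdots<1_{d-1}<2_0<3_0<\cdots<n_0<2_1<\cdots<n_1<\cdots<2_{d-1}<\cdots<n_{d-1}.$$ For $p=(\pi,c)\in\mathfrak{S}_n^d$: - $\mathrm{ldes}(p)=|\{i\in[n-1]:(\pi_i,c_i)>_{\mathrm{mo}}(\pi_{i+1},c_{i+1})\}|$;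 - $\mathrm{lexc}(p)=|\{i\in[n]:(\pi_{\pi_i},c_{\pi_i})>_{\mathrm{mo}}(\pi_i,c_i)\}|$. *)

(* Defs.v *)
From mathcomp Require Import all_boot all_fingroup.
Set Implicit Arguments.
Unset Strict Implicit.
Unset Printing Implicit Defensive.

(* Colored permutations (pi, c).  Positions and the values of pi are the
   ordinals 0, ..., n - 1, standing for 1, ..., n. *)
Definition cperm (n d : nat) := ('S_n * {ffun 'I_n -> 'I_d})%type.

(* The pair (pi_k, c_k), with pi_k shifted back so that it ranges over 1..n. *)
Definition letter (n d : nat) (p : cperm n d) (k : 'I_n) : nat * nat :=
  ((p.1 k).+1, nat_of_ord (p.2 k)).

(* Strict min-one order; mo_chain below lists the letters in increasing order
   and mo_chain_sorted checks the agreement. *)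
Definition mo_lt (a b : nat * nat) : bool :=
  if a.1 == 1 then (b.1 != 1) || (a.2 < b.2)
  else (b.1 != 1) && ((a.2 < b.2) || (a.2 == b.2) && (a.1 < b.1)).

Definition mo_gt (a b : nat * nat) : bool := mo_lt b a.

(* 1_0, ..., 1_(d-1), 2_0, ..., n_0, 2_1, ..., n_1, ..., 2_(d-1), ..., n_(d-1) *)
Definition mo_chain (n d : nat) : seq (nat * nat) :=
  [seq (1, c) | c <- iota 0 d] ++
  [seq (i, c) | c <- iota 0 d, i <- iota 2 n.-1].

Lemma mo_lt_irr : irreflexive mo_lt.
Proof. by case=> i c; rewrite /mo_lt /= !ltnn andbF !orbF; case: eqP. Qed.

Lemma mo_lt_trans : transitive mo_lt.
Proof.
case=> [j b] [i a] [k c]; rewrite /mo_lt /=.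
case: (i == 1); case: (j == 1); case: (k == 1) => //=; first exact: ltn_trans.
case/orP=> [ab|/andP[/eqP-> ij]]; case/orP=> [bc|/andP[/eqP<- jk]].
- by rewrite (ltn_trans ab bc).
- by rewrite ab.
- by rewrite bc.
- by rewrite eqxx (ltn_trans ij jk) orbT.
Qed.

Lemma mo_chain_sorted n d : sorted mo_lt (mo_chain n d).
Proof.
rewrite (sorted_pairwise mo_lt_trans) pairwise_cat; apply/and3P; split.
- apply/allrelP=> x y /mapP[c _ ->] /allpairsP[[c' i] /= [_]].
  by rewrite mem_iota => /andP[i2 _] ->; rewrite /mo_lt /= gtn_eqF.
- by rewrite pairwise_map -(sorted_pairwise ltn_trans) iota_ltn_sorted.
have [m ->] : exists m, iota 0 d = iota m d by exists 0.
elim: d m => //= d IH m; rewrite pairwise_cat IH andbT; apply/andP; split.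
  apply/allrelP=> x y /mapP[i]; rewrite mem_iota => /andP[i2 _] ->.
  case/allpairsP=> [[c j] /= []]; rewrite !mem_iota.
  by move=> /andP[mc _] /andP[j2 _] ->; rewrite /mo_lt /= (gtn_eqF i2) (gtn_eqF j2) mc.
rewrite pairwise_map.
apply: (@sub_in_pairwise _ [pred i | 1 < i] ltn).
- by move=> i j; rewrite !inE /mo_lt /= eqxx ltnn => i1 j1 ->; rewrite !gtn_eqF.
- by apply/allP=> i; rewrite mem_iota => /andP[].
by rewrite -(sorted_pairwise ltn_trans) iota_ltn_sorted.
Qed.

Lemma mem_mo_chain n d i c :
  0 < n -> ((i, c) \in mo_chain n d) = (0 < i <= n) && (c < d).
Proof.
move=> n0; rewrite mem_cat; apply/orP/idP.
  case=> [/mapP[c' + [-> ->]]|/allpairsP[[c' i'] /= [+ + [-> ->]]]].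
    by rewrite mem_iota n0.
  rewrite !mem_iota add0n => /= -> /andP[i2]; rewrite addSnnS prednK // addnC addn1.
  by rewrite ltnS => ->; rewrite (ltnW i2).
case/andP=> /andP[i0 iN] cd; case: (ltngtP i 1) i0 => // [i1|->] _; [right|left].
  apply/allpairsP; exists (c, i); split; rewrite ?mem_iota //=.
  by rewrite i1 addSnnS prednK // add1n.
by apply/mapP; exists c; rewrite ?mem_iota.
Qed.

(* The last position has no successor k, so i ranges over the first n - 1. *)
Definition ldes (n d : nat) (p : cperm n d) : nat :=
  #|[set i : 'I_n | [exists k : 'I_n,
       (k == i.+1 :> nat) && mo_gt (letter p i) (letter p k)]]|.

Definition lexc (n d : nat) (p : cperm n d) : nat :=
  #|[set i : 'I_n | mo_gt (letter p (p.1 i)) (letter p i)]|.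

(* The index k with value 0 is the first position. *)
Definition Sfirst (n d i j : nat) : {set cperm n d} :=
  [set p : cperm n d | [exists k : 'I_n, (k == 0 :> nat) && (letter p k == (i, j))]].

(* Main.v *)
(* Fix the colour of every letter.  Replacing letters by their ranks in the
   min-one order turns ldes into the descent number of a permutation, and,
   after conjugating by the ranking, lexc into the excedance number; the letter
   1 always has rank 0.  Reversing the colours together with the letters other
   than 1 reverses these ranks, i.e. negates them modulo n.  So it is enough to
   show that descents over permutations with first value r are distributed as
   excedances over permutations with first value -r mod n.  This is an induction
   on n: deleting the first letter gives a recurrence in r for the descent
   polynomials, and exchanging two consecutive values, then deleting a fixed
   point, gives the reversed recurrence for the excedance polynomials. *)
Require Import Defs.
From mathcomp Require Import all_boot all_fingroup.
From mathcomp Require Import all_algebra.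
From mathcomp Require Import zify ring.
Import GRing.Theory.

Set Implicit Arguments.
Unset Strict Implicit.
Unset Printing Implicit Defensive.

(** The m-th element of each fiber of [f] goes to the m-th element of the fiber of [g] over the same
    value. *)
Lemma equinumerous_fibers (T : finType) (K : eqType) (f g : T -> K) :
  (forall k, #|[pred x | f x == k]| = #|[pred x | g x == k]|) ->
  exists2 h : T -> T, injective h & forall x, g (h x) = f x.
Proof.
move=> fg; pose F k := enum [pred x | f x == k].
pose G k := enum [pred x | g x == k].
have lt_index x : index x (F (f x)) < size (G (f x)).
  by rewrite -cardE -fg cardE index_mem mem_enum inE.
(* Equal sizes keep the index in range, so the default [x] is never returned. *)
pose h x := nth x (G (f x)) (index x (F (f x))).
have gh x : g (h x) = f x.
  by have := mem_nth x (lt_index x); rewrite mem_enum inE => /eqP.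
exists h => // x y hxy; have fxy : f x = f y by rewrite -!gh hxy.
move: hxy; rewrite /h (set_nth_default x y (lt_index y)) -fxy => /eqP.
have lty := lt_index y; rewrite -fxy in lty.
rewrite nth_uniq ?lt_index ?enum_uniq // => /eqP.
by apply: (index_inj x); rewrite mem_enum inE ?fxy.
Qed.

(** * Descents and excedances of permutations *)

Section Eulerian.

Definition des n (s : 'S_n.+1) : nat :=
  \sum_(i < n) (s (lift ord0 i) < s (widen_ord (leqnSn n) i)).

Definition exc n (s : 'S_n) : nat := \sum_(i < n) (i < s i).

Lemma lift_perm_inj n (i j : 'I_n.+1) : injective (lift_perm i j).
Proof.
move=> s t st; apply/permP=> k; apply: (@lift_inj _ j).
by rewrite -!(lift_perm_lift i) st.
Qed.

Lemma lift_perm_onto n (i j : 'I_n.+1) (s : 'S_n.+1) :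
  s i = j -> exists t, s = lift_perm i j t.
Proof.
move=> sij; have neq k : j != s (lift i k).
  by rewrite -sij (inj_eq perm_inj) neq_lift.
pose f k := odflt k (unlift j (s (lift i k))).
have fE k : lift j (f k) = s (lift i k).
  by rewrite /f; case: unliftP (neq k) => [k' -> //|->]; rewrite eqxx.
have f_inj : injective f.
  by move=> k l /(congr1 (lift j)); rewrite !fE => /perm_inj/lift_inj.
exists (perm f_inj); apply/permP=> k; case: (unliftP i k) => [l|] ->.
  by rewrite lift_perm_lift permE fE.
by rewrite lift_perm_id.
Qed.

Lemma sum_lift_perm (R : nmodType) n (i j : 'I_n.+1) (F : 'S_n.+1 -> R) :
  (\sum_(s : 'S_n.+1 | s i == j) F s = \sum_t F (lift_perm i j t))%R.
Proof.
have -> : (\sum_(s : 'S_n.+1 | s i == j) F s =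
           \sum_(s in [set lift_perm i j t | t : 'S_n]) F s)%R.
  apply: eq_bigl => s; apply/eqP/imsetP => [/lift_perm_onto[t ->]|[t _ ->]].
    by exists t.
  exact: lift_perm_id.
by rewrite big_imset /=; [apply: eq_bigl | move=> s t _ _ /lift_perm_inj].
Qed.

Lemma ltn_lift n (j : 'I_n.+1) (a b : 'I_n) : (lift j a < lift j b) = (a < b).
Proof. by rewrite /= /bump; lia. Qed.

(** The values from [r] up are shifted, so the first gap is a descent exactly when [t ord0 < r];
    [lift] preserves all other comparisons. *)
Lemma des_lift_perm0 n (r : 'I_n.+2) (t : 'S_n.+1) :
  des (lift_perm ord0 r t) = (t ord0 < r) + des t.
Proof.
rewrite /des big_ord_recl lift_perm_lift.
have -> : widen_ord (leqnSn n.+1) ord0 = ord0 by apply: val_inj.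
rewrite lift_perm_id; congr (_ + _).
  by rewrite /= /bump; congr nat_of_bool; lia.
apply: eq_bigr => i _.
have -> : widen_ord (leqnSn n.+1) (lift ord0 i) =
          lift ord0 (widen_ord (leqnSn n) i) by apply: val_inj.
by rewrite !lift_perm_lift ltn_lift.
Qed.

Lemma exc_lift_perm n (j : 'I_n.+1) (t : 'S_n) : exc (lift_perm j j t) = exc t.
Proof.
rewrite /exc (bigD1_ord j) //= lift_perm_id ltnn.
by apply: eq_bigr => i _; rewrite lift_perm_lift ltn_lift.
Qed.

(** The values [a] and [a.+1] are exchanged. Position 0 loses its excedance exactly when [a] is 0;
    the position of [a] gains one exactly when it was a fixed point. *)
Lemma exc_mul_tperm n (a b : 'I_n.+1) (s : 'S_n.+1) :
  b = a.+1 :> nat -> s ord0 = b ->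
  exc (s * tperm a b)%g + (a == ord0) = exc s + (s a == a).
Proof.
move=> ba s0; have neq_ab : (a == b) = false.
  by apply/eqP=> ab; move: ba; rewrite ab; lia.
(* The identity holds term by term once both corrections are written as sums
   over the positions. *)
have -> : (a == ord0 : nat) = \sum_(i < n.+1) ((i == ord0) && (a == ord0)).
  by rewrite (bigD1 ord0) //= big1 ?addn0 // => i /negbTE->.
have -> : (s a == a : nat) = \sum_(i < n.+1) ((i == a) && (s i == a)).
  by rewrite (bigD1 a) //= eqxx big1 ?addn0 // => i /negbTE->.
rewrite /exc -!big_split /=; apply: eq_bigr => i _; rewrite permM.
have [->|i0] := eqVneq i ord0.
  rewrite s0 tpermR ba [b == a]eq_sym neq_ab andbF addn0 /= -val_eqE /=.
  by case: (val a).
have [sia|sia] := eqVneq (s i) a; last have [sib|sib] := eqVneq (s i) b.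
- by rewrite sia tpermL ba andbT -(inj_eq val_inj i a) /=; lia.
- by case/eqP: i0; apply: (@perm_inj _ s); rewrite sib.
- by rewrite tpermD 1?eq_sym // andbF.
Qed.

(** * Generating polynomials refined by the first value *)

Local Open Scope ring_scope.

Definition despoly n (r : nat) : {poly int} :=
  \sum_(s : 'S_n.+1 | s ord0 == r :> nat) 'X^(des s).

Definition excpoly n (r : nat) : {poly int} :=
  \sum_(s : 'S_n.+1 | s ord0 == r :> nat) 'X^(exc s).

Lemma sum_perm0 n (F : 'S_n.+1 -> {poly int}) :
  \sum_s F s = \sum_(r < n.+1) \sum_(s : 'S_n.+1 | s ord0 == r :> nat) F s.
Proof. by rewrite (partition_big (fun s : 'S_n.+1 => s ord0) xpredT). Qed.

Lemma despoly_lift n r : (r < n.+2)%N ->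
  despoly n.+1 r = \sum_(t : 'S_n.+1) 'X^((t ord0 < r) + des t).
Proof.
move=> rn; rewrite /despoly (sum_lift_perm ord0 (Ordinal rn)).
by apply: eq_bigr => t _; rewrite des_lift_perm0.
Qed.

Lemma despoly0 n : despoly n.+1 0 = \sum_(t : 'S_n.+1) 'X^(des t).
Proof. by rewrite despoly_lift. Qed.

Lemma despoly_max n : despoly n.+1 n.+1 = 'X * \sum_(t : 'S_n.+1) 'X^(des t).
Proof.
rewrite despoly_lift // mulr_sumr; apply: eq_bigr => t _.
by rewrite ltn_ord exprS.
Qed.

(** Raising the first value from [r] to [r.+1] creates a descent exactly when the rest standardizes
    to a permutation starting with [r]. *)
Lemma despolyS n r : (r <= n)%N ->
  despoly n.+1 r.+1 = despoly n.+1 r + ('X - 1) * despoly n r.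
Proof.
move=> rn; rewrite !despoly_lift ?ltnS ?(leq_trans rn) //.
rewrite /despoly mulr_sumr [X in _ + X]big_mkcond -big_split /=.
apply: eq_bigr => t _; rewrite ltnS leq_eqVlt; case: eqP => [->|_]; last by rewrite addr0.
by rewrite ltnn /= exprS; ring.
Qed.

Lemma excpoly0 n : excpoly n.+1 0 = \sum_(t : 'S_n.+1) 'X^(exc t).
Proof.
rewrite /excpoly (sum_lift_perm ord0 ord0).
by apply: eq_bigr => t _; rewrite exc_lift_perm.
Qed.

Lemma excpoly_swap n (a b : 'I_n.+1) : b = a.+1 :> nat ->
  'X^(a == ord0) * excpoly n a =
  \sum_(s : 'S_n.+1 | s ord0 == b) 'X^(exc s + (s a == a)).
Proof.
move=> ba; rewrite mulr_sumr (reindex_inj (mulIg (tperm a b))) /=.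
have tab_inj := @perm_inj _ (tperm a b).
apply: eq_big => [s|s]; rewrite permM val_eqE -(inj_eq tab_inj) tpermK tpermL //.
by move=> /eqP s0; rewrite -(exc_mul_tperm ba) // addnC exprD.
Qed.

Lemma excpoly1 n : excpoly n.+1 1 = 'X * excpoly n.+1 0.
Proof.
have := @excpoly_swap n.+1 ord0 (lift ord0 ord0) erefl.
rewrite eqxx expr1 => ->.
apply: eq_big => [s|s /eqP s0]; first by rewrite -[RHS]val_eqE.
by rewrite -[s _ == _]val_eqE /= s0 addn0.
Qed.

(** On permutations starting with [a.+1], the exchange of values costs a factor ['X] exactly when
    [a] is fixed; deleting that fixed point leaves a smaller permutation starting with [a]. *)
Lemma excpolyS n a : (0 < a <= n)%N ->
  excpoly n.+1 a = excpoly n.+1 a.+1 + ('X - 1) * excpoly n a.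
Proof.
case/andP=> a0 an; have ha : (a < n.+2)%N by lia.
have hb : (a.+1 < n.+2)%N by lia.
have := @excpoly_swap n.+1 (Ordinal ha) (Ordinal hb) erefl.
rewrite -val_eqE /= eqn0Ngt a0 expr0 mul1r => ->.
set o := Ordinal ha; set o' := Ordinal hb.
have -> : excpoly n a =
    \sum_(s : 'S_n.+2 | (s ord0 == o') && (s o == o)) 'X^(exc s).
  rewrite (eq_bigl _ _ (fun s => andbC _ _)) big_mkcondr /= sum_lift_perm.
  rewrite /excpoly big_mkcond; apply: eq_bigr => t _; rewrite exc_lift_perm.
  (* As [a] is positive, position 0 survives the deletion. *)
  have -> : ord0 = lift o ord0 by apply: val_inj; rewrite /= /bump leqNgt a0.
  rewrite lift_perm_lift -[_ == o']val_eqE /= /bump.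
  by congr (if _ then _ else _); lia.
rewrite /excpoly mulr_sumr big_mkcondr /= -big_split /=.
apply: eq_bigr => s _; case: eqP => _; last by rewrite addn0 addr0.
by rewrite addn1 exprS; ring.
Qed.

(** The right index is [- r] modulo [n.+1]. The recurrences [despolyS] and [excpolyS] run in
    opposite directions, with correction terms matched by the induction on [n]. *)
Lemma despoly_excpoly n r : (r < n.+1)%N ->
  despoly n r = excpoly n ((n.+1 - r) %% n.+1).
Proof.
elim: n r => [|n IHn] r rn.
  rewrite (_ : r = 0)%N; last lia.
  apply: eq_bigr => s _; rewrite /des /exc big_ord0 big_ord1.
  by rewrite [s _]ord1.
(* The induction hypothesis is summed over first values: 0 matches 0 and the others are reversed. *)
have total : \sum_(t : 'S_n.+1) 'X^(des t) =
             \sum_(t : 'S_n.+1) 'X^(exc t) :> {poly int}.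
  rewrite !sum_perm0 [RHS]big_ord_recl [LHS]big_ord_recl; congr (_ + _).
    by have := IHn 0%N isT; rewrite subn0 modnn.
  rewrite [RHS](reindex_inj rev_ord_inj); apply: eq_bigr => i _.
  rewrite -[LHS]/(despoly n (lift ord0 i)).
  rewrite -[RHS]/(excpoly n (lift ord0 (rev_ord i))).
  rewrite IHn // modn_small /= /bump; have := ltn_ord i; last by lia.
  by move=> ?; congr excpoly; lia.
case: r rn => [|r] rn; first by rewrite subn0 modnn despoly0 excpoly0.
rewrite modn_small; last lia.
(* Downward induction on the first value, starting from its maximum n + 1. *)
have [s + ->] : exists2 s, (s <= n)%N & r = (n - s)%N by exists (n - r)%N; lia.
elim: s {r rn} => [_|s IHs sn].
  by rewrite subn0 subSnn despoly_max excpoly1 excpoly0 total.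
have -> : (n.+2 - (n - s.+1).+1 = s.+2)%N by lia.
have := IHs (ltnW sn); rewrite (_ : (n.+2 - (n - s).+1 = s.+1)%N); last by lia.
rewrite despolyS ?leq_subr // excpolyS ?sn // IHn ?ltnS ?leq_subr //.
rewrite modn_small; last by lia.
rewrite (_ : (n.+1 - (n - s) = s.+1)%N); last by lia.
by move/addIr; rewrite -subSn // subSS.
Qed.

Lemma coef_sum_Xn (T : finType) (P : pred T) (F : T -> nat) k :
  (\sum_(x | P x) 'X^(F x) : {poly int})`_k = #|[pred x | P x & F x == k]|%:R.
Proof.
rewrite coef_sum -sum1_card natr_sum big_mkcondr; apply: eq_bigr => x _.
by rewrite coefXn eq_sym; case: eqP.
Qed.

(** The minus sign is negation modulo [n.+1]; equal coefficients of the polynomials give equal fiber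
    sizes. *)
Lemma des_exc_bijection n :
  exists2 g : 'S_n.+1 -> 'S_n.+1, injective g &
    forall s, exc (g s) = des s /\ g s ord0 = - s ord0.
Proof.
have [[r k]|g g_inj gE] := @equinumerous_fibers 'S_n.+1 ('I_n.+1 * nat)%type
    (fun s => (- s ord0, des s)) (fun s => (s ord0, exc s)).
  have E : despoly n (- r) = excpoly n r.
    by rewrite despoly_excpoly // -[X in excpoly n X]/(val (- - r)) opprK.
  have := congr1 (fun p : {poly int} => p`_k) E.
  rewrite /= !coef_sum_Xn => /eqP; rewrite Num.Theory.eqr_nat => /eqP Ek.
  transitivity #|[pred s : 'S_n.+1 | s ord0 == - r & des s == k]|.
    by apply: eq_card => s; rewrite !inE xpair_eqE eqr_oppLR.
  by rewrite Ek.
by exists g => // s; case: (gE s).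
Qed.

End Eulerian.

(** * Standardization by ranks of letters *)

Section Standardization.

Variables n d : nat.
Implicit Types (e : {ffun 'I_n.+1 -> 'I_d}) (p : cperm n.+1 d) (v w : 'I_n.+1).

(** Colours are attached to values, so that the order does not depend on the permutation. *)
Definition letter_lt e v w : bool :=
  mo_lt (v.+1, nat_of_ord (e v)) (w.+1, nat_of_ord (e w)).

Lemma letter_lt_irr e : irreflexive (letter_lt e).
Proof. by move=> v; apply: mo_lt_irr. Qed.

Lemma letter_lt_trans e : transitive (letter_lt e).
Proof. by move=> v u w; apply: mo_lt_trans. Qed.

Lemma letter_lt_total e v w : v != w -> letter_lt e v w || letter_lt e w v.
Proof.
rewrite -val_eqE /letter_lt /mo_lt /= !eqSS !ltnS.
move: (val v) (val w) (val (e v)) (val (e w)) => a b i j.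
by case: (ltngtP i j); case: (ltngtP a b); case: eqP; case: eqP; lia.
Qed.

Lemma letter_lt0 e v : letter_lt e v ord0 = false.
Proof.
have [->|v0] := eqVneq v ord0; first exact: letter_lt_irr.
by move: v0; rewrite -val_eqE /letter_lt /mo_lt /= eqSS => /negbTE->.
Qed.

Lemma letter_lt_asym e v w : letter_lt e v w = (v != w) && ~~ letter_lt e w v.
Proof.
have [->|vw] := eqVneq v w; first exact: letter_lt_irr.
have := letter_lt_total e vw; case wv: (letter_lt e w v); last by rewrite orbF.
by move=> _; apply/negP=> /letter_lt_trans/(_ wv); rewrite letter_lt_irr.
Qed.

Definition letter_rank e v : nat := #|[set w | letter_lt e w v]|.

Lemma ltn_letter_rank e v w :
  (letter_rank e v < letter_rank e w) = letter_lt e v w.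
Proof.
have mono x y : letter_lt e x y -> letter_rank e x < letter_rank e y.
  move=> xy; apply/proper_card/properP; split.
    by apply/subsetP=> u; rewrite !inE => /letter_lt_trans; apply.
  by exists x; rewrite !inE ?letter_lt_irr.
apply/idP/idP=> [|/mono//]; have [->|vw] := eqVneq v w; first by rewrite ltnn.
by case/orP: (letter_lt_total e vw) => // /mono; lia.
Qed.

Lemma letter_rank_ltn e v : letter_rank e v < n.+1.
Proof.
rewrite -[n.+1]card_ord -cardsT; apply/proper_card/properP.
by split; [apply: subsetT | exists v; rewrite !inE ?letter_lt_irr].
Qed.

Lemma letter_rank_inj e : injective (fun v => Ordinal (letter_rank_ltn e v)).
Proof.
move=> v w /(congr1 val) /= vw; apply/eqP/negPn/negP=> /(letter_lt_total e).
by rewrite -!ltn_letter_rank vw ltnn.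
Qed.

Definition rank_perm e : 'S_n.+1 := perm (@letter_rank_inj e).

Lemma val_rank_perm e v : rank_perm e v = letter_rank e v :> nat.
Proof. by rewrite permE. Qed.

Lemma rank_perm0 e : rank_perm e ord0 = ord0.
Proof.
apply: val_inj; rewrite /= val_rank_perm; apply: eq_card0 => v.
by rewrite !inE letter_lt0.
Qed.

(* The colours indexed by values instead of positions. *)
Definition letter_color p : {ffun 'I_n.+1 -> 'I_d} :=
  [ffun v => p.2 ((p.1)^-1%g v)].

Lemma letter_colorE p i : letter_color p (p.1 i) = p.2 i.
Proof. by rewrite ffunE permK. Qed.

Lemma mo_lt_letter p i k : mo_lt (letter p i) (letter p k) =
  (rank_perm (letter_color p) (p.1 i) < rank_perm (letter_color p) (p.1 k)).
Proof. by rewrite !val_rank_perm ltn_letter_rank /letter_lt !letter_colorE. Qed.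

Lemma ldes_standard p : ldes p = des (p.1 * rank_perm (letter_color p))%g.
Proof.
rewrite /ldes /des cardsE -sum1_card big_mkcond big_ord_recr /=.
rewrite [ord_max \in _]unfold_in /=.
case: existsP => [[k /andP[/eqP kE _]]|_].
  by have := ltn_ord k; rewrite kE ltnn.
rewrite addn0; apply: eq_bigr => i _; rewrite !permM -mo_lt_letter unfold_in /=.
have -> : [exists k : 'I_n.+1, (k == i.+1 :> nat) &&
    mo_gt (letter p (widen_ord (leqnSn n) i)) (letter p k)] =
  mo_lt (letter p (lift ord0 i)) (letter p (widen_ord (leqnSn n) i)).
  apply/existsP/idP => [[k /andP[/eqP kE]]|lt]; last first.
    by exists (lift ord0 i); rewrite eqxx.
  by rewrite (_ : k = lift ord0 i) //; apply: val_inj.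
by case: ifP.
Qed.

(** Position [i] corresponds to the rank of its letter, which the conjugate sends to the rank of the
    letter at position [p.1 i]. *)
Lemma lexc_standard p :
  let r := rank_perm (letter_color p) in lexc p = exc (r^-1 * p.1 * r)%g.
Proof.
rewrite /= /lexc /exc cardsE -sum1_card big_mkcond /=.
rewrite [RHS](reindex_inj (@perm_inj _ (p.1 * rank_perm (letter_color p))%g)).
apply: eq_bigr => i _; rewrite !permM permK unfold_in /= /mo_gt mo_lt_letter.
by case: ifP.
Qed.

(** * Reversal of colours and letters *)

Local Open Scope ring_scope.

(** Negation modulo [n.+1] fixes 0, the letter 1, and reverses the other values. *)
Definition reflect_color e : {ffun 'I_n.+1 -> 'I_d} :=
  [ffun v => rev_ord (e (- v))].

Lemma reflect_colorK : involutive reflect_color.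
Proof. by move=> e; apply/ffunP=> v; rewrite !ffunE opprK rev_ordK. Qed.

Lemma letter_lt_reflect e v w : v != ord0 -> w != ord0 ->
  letter_lt (reflect_color e) (- v) (- w) = letter_lt e w v.
Proof.
rewrite /letter_lt !ffunE !opprK -!val_eqE /= => v0 w0.
have nv := ltn_ord v; have nw := ltn_ord w.
have dv := ltn_ord (e v); have dw := ltn_ord (e w).
rewrite /mo_lt /= !modn_small ?eqSS; try lia.
rewrite (negbTE v0) (negbTE w0) !subn_eq0 leqNgt nv leqNgt nw /=.
move: (val (e v)) (val (e w)) dv dw => a b dv dw; lia.
Qed.

(** For [v] nonzero of rank [k], the letters below the reflected one are the letter 1 and the
    reflections of the [n - k] letters above [v], hence [n.+1 - k] in all. *)
Lemma rank_perm_reflect e v :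
  rank_perm (reflect_color e) (- v) = - rank_perm e v.
Proof.
have [->|v0] := eqVneq v ord0; first by rewrite oppr0 !rank_perm0 oppr0.
apply: val_inj; rewrite /= !val_rank_perm.
have rv : (0 < letter_rank e v)%N.
  rewrite lt0n -val_rank_perm (val_eqE _ ord0).
  by rewrite -(rank_perm0 e) (inj_eq perm_inj).
have nv := letter_rank_ltn e v.
rewrite modn_small; last lia.
have -> : letter_rank (reflect_color e) (- v) =
          #|~: (v |: [set w | letter_lt e w v] :\ ord0)|.
  rewrite -[RHS](card_imset _ (@oppr_inj _)); apply: eq_card => w.
  rewrite -[w]opprK (mem_imset _ _ (@oppr_inj _)) !inE; move: (- w) => {w} w.
  have [->|w0] := eqVneq w ord0.
    by rewrite oppr0 letter_lt_asym letter_lt0 eq_sym oppr_eq0 v0 orbF eq_sym.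
  by rewrite letter_lt_reflect // letter_lt_asym negb_or eq_sym.
have := cardsC (v |: [set w | letter_lt e w v] :\ ord0).
rewrite cardsU1 card_ord.
have := cardsD1 ord0 [set w | letter_lt e w v].
rewrite !inE letter_lt_irr andbF (letter_lt_asym e ord0) letter_lt0 eq_sym v0.
by rewrite -/(letter_rank e v); lia.
Qed.

End Standardization.

(** * The bijection on coloured permutations and its effect on first letters *)

Theorem theorem4 (n d : nat) (hn : 0 < n) (hd : 0 < d) :
  exists Gamma : cperm n d -> cperm n d,
    [/\ bijective Gamma,
        forall p : cperm n d, ldes p = lexc (Gamma p),
        forall i j : nat, 2 <= i <= n -> j < d ->
          Gamma @: Sfirst n d i j = Sfirst n d (n + 2 - i) (d - 1 - j)
      & forall j : nat, j < d ->
          Gamma @: Sfirst n d 1 j = Sfirst n d 1 (d - 1 - j)].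
Proof.
case: n hn => // n _; have [g g_inj gE] := des_exc_bijection n.
(* The factors around [g] undo the conjugation in [lexc_standard]. *)
pose Gpi (p : cperm n.+1 d) : 'S_n.+1 :=
  let r := rank_perm (reflect_color (letter_color p)) in
  (r * g (p.1 * rank_perm (letter_color p)) * r^-1)%g.
pose Gamma p : cperm n.+1 d :=
  (Gpi p, [ffun i => reflect_color (letter_color p) (Gpi p i)]).
have color_Gamma p : letter_color (Gamma p) = reflect_color (letter_color p).
  by apply/ffunP=> v; rewrite ffunE /= ffunE permKV.
have Gamma_inj : injective Gamma.
  (* [reflect_color] is injective, so the colours are recovered first; then the factors around [g]
     cancel. *)
  move=> p q pq; have epq : letter_color p = letter_color q.
    by apply: (can_inj (@reflect_colorK n d)); rewrite -!color_Gamma pq.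
  have [+ _] := pq; rewrite /Gpi epq => /mulIg/mulgI/g_inj/mulIg pi_pq.
  rewrite [p]surjective_pairing [q]surjective_pairing pi_pq; congr pair.
  by apply/ffunP=> i; rewrite -!letter_colorE epq pi_pq.
have first1 p : (Gamma p).1 ord0 = (- p.1 ord0)%R.
  rewrite /= /Gpi !permM rank_perm0.
  have [_ ->] := gE (p.1 * rank_perm (letter_color p))%g.
  by rewrite permM -rank_perm_reflect permK.
have first2 p : (Gamma p).2 ord0 = rev_ord (p.2 ord0).
  by rewrite ffunE -/(Gamma p).1 first1 ffunE opprK letter_colorE.
have SfirstE (p : cperm n.+1 d) i j :
    (p \in Sfirst n.+1 d i j) = (letter p ord0 == (i, j)).
  rewrite inE; apply/existsP/idP => [[k /andP[/eqP k0]]|?]; last by exists ord0.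
  by rewrite (_ : k = ord0) //; apply: val_inj.
have Gamma_bij := injF_bij Gamma_inj; have [h _ hK] := Gamma_bij.
(* As [Gamma] is bijective, only first letters need to be compared. *)
have image_first i j i' j' :
    (forall v c, (((v : 'I_n.+1).+1 == i) && ((c : 'I_d) == j :> nat)) =
                 (((- v)%R : 'I_n.+1).+1 == i') && (rev_ord c == j' :> nat)) ->
    Gamma @: Sfirst n.+1 d i j = Sfirst n.+1 d i' j'.
  move=> E; apply/setP=> q; rewrite -[q]hK (mem_imset _ _ Gamma_inj) !SfirstE.
  by rewrite /letter first1 first2 !xpair_eqE E.
exists Gamma; split=> //.
- move=> p; rewrite ldes_standard lexc_standard color_Gamma /= /Gpi.
  rewrite !mulgA mulVg mul1g mulgKV.
  by case: (gE (p.1 * rank_perm (letter_color p))%g).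
- move=> i j i2 jd; apply: image_first => v c.
  have vn := ltn_ord v; have cd := ltn_ord c.
  (* At [v = 0] the residue of [n.+1 - v] wraps to 0. *)
  have [->|v0] := eqVneq v ord0; first by rewrite oppr0 /=; lia.
  by rewrite -val_eqE /= in v0; rewrite /= modn_small; lia.
- move=> j jd; apply: image_first => v c.
  have vn := ltn_ord v; have cd := ltn_ord c.
  have [->|v0] := eqVneq v ord0; first by rewrite oppr0 /=; lia.
  by rewrite -val_eqE /= in v0; rewrite /= modn_small; lia.
Qed.
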